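(* Let $\mathcal G=((V,E),(V_1,V_2,V_\Diamond),\delta,w)$ be a stochastic game, $\varphi$ a bounded prefix-independent objective, and consider the classes of the expected value vector $\mathsf r^*=(\mathbb{E}_v(\varphi))_{v\in V}$. Let $N$ be the maximum denominator (in lowest terms) of the probabilities $\delta(v)(v')$ occurring in $\mathcal G$, and let $B_0$ be a positive integer such that the value of every $\mathsf r^*$-class without boundary vertices can be written as $p/q$ with integers $p,q$, $0<q\le B_0$. Then the value of every $\mathsf r^*$-class can be written as $p/q$ with integers $p,q$ and $0<q\le 2^{|V|}\cdot N^{|V|^3}\cdot B_0^{|V|}$.
   Context: A stochastic game is $\mathcal{G}=((V,E),(V_1,V_2,V_\Diamond),\delta,w)$ where $(V,E)$ is a finite directed graph in which every vertex $v$ has a nonempty set $E(v)=\{v' : (v,v')\in E\}$ of out-neighbours; $(V_1,V_2,V_\Diamond)$ partitions $V$ into vertices of Player 1, of Player 2, and probabilistic vertices; $\delta$ assigns to each $v\in V_\Diamond$ a probability distribution on $E(v)$ with rational values, positive on every out-neighbour; $w:E\to\mathbb{Q}$ is a payoff function. Plays are infinite paths; deterministic strategies of Player $i$ map finite prefixes ending in $V_i$ to an out-neighbour of the last vertex; a strategy pair and initial vertex induce a probability measure on plays. An objective $\varphi$ is a Borel-measurable real function on plays; bounded if $|\varphi|\le W_\varphi$ for some integer $W_\varphi$; prefix-independent if plays with a common suffix get equal value. Player 1 maximises, Player 2 minimises the expectation; $\mathbb{E}_v(\varphi)=\sup_{\sigma_1}\inf_{\sigma_2}\mathbb{E}^{\sigma_1,\sigma_2}_v[\varphi]=\inf_{\sigma_2}\sup_{\sigma_1}\mathbb{E}^{\sigma_1,\sigma_2}_v[\varphi]$.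 For a real vector $\mathsf r$ indexed by $V$, its classes are the maximal nonempty sets of vertices on which $\mathsf r$ is constant (the value of the class is this constant); a vertex $v$ of a class $C$ is a boundary vertex if $v\in V_\Diamond$ and $E(v)\not\subseteq C$. *)

(* Defs.v *)
From HB Require Import structures.
From mathcomp Require Import all_boot all_order all_algebra.
From mathcomp Require Import all_classical all_reals all_analysis.
Set Implicit Arguments.
Unset Strict Implicit.
Unset Printing Implicit Defensive.
Import Order.TTheory GRing.Theory Num.Theory.
Local Open Scope classical_set_scope.
Local Open Scope ring_scope.

Inductive owner := Player1 | Player2 | Random.
Definition is_random (o : owner) : bool := if o is Random then true else false.

Record game (V : finType) := Game {
  edge : rel V;
  own : V -> owner;
  delta : V -> V -> rat;        (* delta v v' = delta(v)(v') (meaningful for v' in E(v)) *)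
  payoff : V -> V -> rat        (* w (not used by the objective phi) *)
}.

Definition wf_game (V : finType) (G : game V) : Prop :=
  (forall v, exists v', edge G v v') /\
  (forall v, own G v = Random ->
     (forall v', edge G v v' -> 0 < delta G v v') /\
     \sum_(v' | edge G v v') delta G v v' = 1).

(* Deterministic strategy of player i: maps a prefix (h ++ [:: v]) with v
   owned by i to an out-neighbour of v.  Represented as sigma h v. *)
Definition is_strategy (V : finType) (G : game V) (i : owner)
  (sigma : seq V -> V -> V) : Prop :=
  forall h v, own G v = i -> edge G v (sigma h v).

Definition step (R : realType) (V : finType) (G : game V)
  (s1 s2 : seq V -> V -> V) (h : seq V) (v v' : V) : R :=
  match own G v with
  | Player1 => (s1 h v == v')%:R
  | Player2 => (s2 h v == v')%:R
  | Random => if edge G v v' then ratr (delta G v v') else 0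
  end.

Fixpoint path_prob (R : realType) (V : finType) (G : game V)
  (s1 s2 : seq V -> V -> V) (h : seq V) (cur : V) (rest : seq V) : R :=
  match rest with
  | [::] => 1
  | y :: r => step R G s1 s2 h cur y * path_prob R G s1 s2 (rcons h cur) y r
  end.

Definition vseq (V : finType) (v0 : V) := nat -> V.
Arguments vseq {V} v0.
HB.instance Definition _ (V : finType) (v0 : V) :=
  gen_eqMixin (vseq v0).
HB.instance Definition _ (V : finType) (v0 : V) :=
  gen_choiceMixin (vseq v0).
HB.instance Definition _ (V : finType) (v0 : V) :=
  isPointed.Build (vseq v0) (fun _ => v0).

Definition cyl (V : finType) (v0 : V) (s : seq V) : set (vseq v0) :=
  [set rho | forall i, (i < size s)%N -> rho i = nth v0 s i].
Arguments cyl {V} v0 s.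

Definition cylinders (V : finType) (v0 : V) : set (set (vseq v0)) :=
  [set A | exists s : seq V, A = cyl v0 s].
Arguments cylinders {V} v0.

Definition playT (V : finType) (v0 : V) := g_sigma_algebraType (cylinders v0).
Arguments playT {V} v0.

Definition is_play (V : finType) (G : game V) (rho : nat -> V) : Prop :=
  forall i, edge G (rho i) (rho i.+1).

Definition induced_measure (R : realType) (V : finType) (v0 : V) (G : game V)
  (v : V) (s1 s2 : seq V -> V -> V) (P : probability (playT v0) R) : Prop :=
  forall x0 xs,
    P (cyl v0 (x0 :: xs)) = ((x0 == v)%:R * path_prob R G s1 s2 [::] x0 xs)%:E.

Definition expect (R : realType) (V : finType) (v0 : V)
  (P : probability (playT v0) R) (phi : playT v0 -> R) : \bar R :=
  (\int[P]_x (phi x)%:E)%E.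

Definition lower_value (R : realType) (V : finType) (v0 : V) (G : game V)
  (Pm : V -> (seq V -> V -> V) -> (seq V -> V -> V) -> probability (playT v0) R)
  (phi : playT v0 -> R) (v : V) : \bar R :=
  ereal_sup [set x | exists s1, is_strategy G Player1 s1 /\
    x = ereal_inf [set y | exists s2, is_strategy G Player2 s2 /\
                           y = expect (Pm v s1 s2) phi]].

Definition upper_value (R : realType) (V : finType) (v0 : V) (G : game V)
  (Pm : V -> (seq V -> V -> V) -> (seq V -> V -> V) -> probability (playT v0) R)
  (phi : playT v0 -> R) (v : V) : \bar R :=
  ereal_inf [set x | exists s2, is_strategy G Player2 s2 /\
    x = ereal_sup [set y | exists s1, is_strategy G Player1 s1 /\
                           y = expect (Pm v s1 s2) phi]].

Definition bounded_obj (R : realType) (T : Type) (phi : T -> R) : Prop :=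
  exists W : nat, forall x, `|phi x| <= W%:R.

Definition prefix_independent (R : realType) (V : finType) (v0 : V)
  (G : game V) (phi : playT v0 -> R) : Prop :=
  forall (rho rho' : playT v0) (i j : nat), is_play G rho -> is_play G rho' ->
    (forall k, rho (i + k)%N = rho' (j + k)%N) -> phi rho = phi rho'.

Definition boundary_of_class (R : realType) (V : finType) (G : game V)
  (r : V -> R) (v u : V) : Prop :=
  r u = r v /\ own G u = Random /\ exists u', edge G u u' /\ r u' <> r v.

Definition rat_with_den_le (R : realType) (x : R) (B : nat) : Prop :=
  exists p q : int, (0 < q)%R /\ (q <= B%:Z)%R /\ x = p%:~R / q%:~R.

(* N: maximum denominator of the probabilities delta(v)(v'), v in V_Diamond,
   v' in E(v); taken to be at least 1 (= 1 when there is no such probability). *)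
Definition max_den (V : finType) (G : game V) : nat :=
  maxn 1 (\max_(v | is_random (own G v))
            \max_(v' | edge G v v') absz (denq (delta G v v'))).

(* Main.v *)
Require Import Defs.
From HB Require Import structures.
From mathcomp Require Import all_boot all_order all_algebra fingroup perm.
From mathcomp Require Import all_classical all_reals all_analysis.
From mathcomp Require Import measurable_realfun.
Import Order.TTheory GRing.Theory Num.Theory.
Set Implicit Arguments.
Unset Strict Implicit.
Unset Printing Implicit Defensive.
Local Open Scope classical_set_scope.
Local Open Scope ring_scope.

(** At a random vertex the value is the average of the values of the successors:
    the first step of a play splits the induced measure into a mixture of
    measures induced from the successors, and a prefix-independent objective
    does not see that step. Hence the values solve the integer linear system
    with one row per vertex [v]: if the class of [v] has a boundary vertex [u],
    the row is [x v = \sum_w delta u w * x w] cleared of denominators, and otherwise it is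
    [q * x v = p]. The system is nonsingular because the average at [u] involves
    a successor of strictly greater value, and by Cramer's rule the determinant,
    which is at most the product of the l1-norms of the rows, is a common
    denominator of the values. *)

(** * Linear systems over the integers *)

(** Expanding the product of row sums gives one term for every map from rows to columns; the Leibniz
    formula bounds the determinant by the terms of the injective maps, which are the
    permutations. *)
Lemma det_le_prod_row_sum (R : numDomainType) (n : nat) (A : 'M[R]_n) :
  `|\det A| <= \prod_i \sum_j `|A i j|.
Proof.
rewrite bigA_distr_bigA /=; apply: le_trans (ler_norm_sum _ _ _) _ => /=.
under eq_bigr do rewrite normrM normr_sign mul1r normr_prod.
rewrite [leRHS](bigID (fun f : {ffun 'I_n -> 'I_n} => injectiveb f)) /=.
apply: ler_wpDr; first by apply: sumr_ge0 => f _; apply: prodr_ge0.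
rewrite (reindex_onto (fun s : 'S_n => pval s)
  (fun f => insubd (1%g : 'S_n) f)) /=; last first.
  by move=> f finj; rewrite insubdK.
rewrite le_eqVlt; apply/orP; left; apply/eqP; apply: congr_big => //.
- by move=> s; rewrite /= (valP s) valKd eqxx.
- by move=> s _; apply: eq_bigr => i _; rewrite pvalE.
Qed.

(** Cramer's rule in adjugate form: [\det A] times the solution is the integer vector
    [\adj A *m B]. *)
Lemma integer_system_den (R : numFieldType) (n : nat) (A : 'M[int]_n)
    (b : 'I_n -> int) (x : 'I_n -> R) :
  \det A != 0 ->
  (forall i, \sum_j (A i j)%:~R * x j = (b i)%:~R) ->
  forall i, exists p q : int,
    [/\ 0 < q, q <= \prod_i \sum_j `|A i j| & x i = p%:~R / q%:~R].
Proof.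
move=> dA Ax i.
pose X : 'cV[R]_n := \col_j x j; pose B : 'cV[int]_n := \col_j b j.
have AX : map_mx intr A *m X = map_mx intr B.
  by apply/colP => j; rewrite !mxE -Ax; apply: eq_bigr => k _; rewrite !mxE.
have dX : (\det A)%:~R * x i = ((\adj A *m B) i 0)%:~R.
  have := congr1 (fun Y => (map_mx intr (\adj A) *m Y) i 0) AX.
  rewrite mulmxA -map_mxM /= mul_adj_mx -map_mxM [in RHS]mxE => <-.
  by rewrite map_scalar_mx mul_scalar_mx !mxE.
have dR : (\det A)%:~R != 0 :> R by rewrite intr_eq0.
(* The sign of the determinant goes into the numerator, which keeps the denominator positive. *)
exists (Num.sg (\det A) * (\adj A *m B) i 0), `|\det A|; split.
- by rewrite normr_gt0.
- exact: det_le_prod_row_sum.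
- rewrite intrM -dX; set d := \det A in dA dR *.
  have nd : `|d|%:~R = (Num.sg d)%:~R * d%:~R :> R.
    by rewrite -intrM -normrEsg.
  have sd : (Num.sg d)%:~R != 0 :> R by rewrite intr_eq0 sgr_eq0.
  by rewrite nd mulrA mulrAC mulfV ?mul1r // mulf_neq0.
Qed.

(** The terms [d i * (c - f i)] are nonnegative and their sum is at most 0, so each vanishes, and
    [d i] is positive. *)
Lemma average_eq_ub (R : realFieldType) (I : finType) (P : pred I)
    (d f : I -> R) (c : R) :
  (forall i, P i -> 0 < d i) -> \sum_(i | P i) d i = 1 ->
  (forall i, P i -> f i <= c) -> c <= \sum_(i | P i) d i * f i ->
  forall i, P i -> f i = c.
Proof.
move=> d0 d1 fc cf i Pi.
have t0 j : P j -> 0 <= d j * (c - f j).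
  by move=> Pj; rewrite mulr_ge0 ?subr_ge0 ?fc // ltW ?d0.
have : \sum_(j | P j) d j * (c - f j) = 0.
  apply/eqP; rewrite eq_le sumr_ge0 // andbT.
  under eq_bigr do rewrite mulrBr.
  by rewrite sumrB -mulr_suml d1 mul1r subr_le0.
move/(psumr_eq0P t0)/(_ i Pi)/eqP.
by rewrite mulf_eq0 gt_eqF ?d0 //= subr_eq0 => /eqP ->.
Qed.

(** * Vectors that are harmonic at the random vertices *)

Section HarmonicVector.
Variables (R : realType) (V : finType) (G : game V) (r : V -> R).
Hypothesis Gwf : wf_game G.
Hypothesis r_harmonic : forall v, own G v = Random ->
  r v = \sum_(v' | edge G v v') ratr (delta G v v') * r v'.

(** Otherwise [r v], the average over the successors of [u], would bound all of them, forcing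
    equality at each and contradicting the successor outside the class. *)
Lemma boundary_has_greater_successor (v u : V) :
  boundary_of_class G r v u -> exists2 u', edge G u u' & r v < r u'.
Proof.
case=> ruv [uR [u' [euu' ru']]].
have [d0 d1] := Gwf.2 _ uR.
apply: contrapT => nex; apply: ru'.
apply: (@average_eq_ub _ _ (edge G u) (fun v' => ratr (delta G u v')) r) => //.
- by move=> i /d0; rewrite ltr0q.
- by rewrite -rmorph_sum /= d1 rmorph1.
- by move=> i ei; rewrite leNgt; apply/negP => h; apply: nex; exists i.
- by rewrite -r_harmonic // ruv.
Qed.

(* The vertices maximising |x| are closed under the chosen averages, but the
   average chosen for one of greatest r among them involves a greater r. *)
Lemma harmonic_kernel_trivial (x : V -> rat) :
  (forall v, x v = 0 \/ exists2 u, boundary_of_class G r v u &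
     x v = \sum_(v' | edge G u v') delta G u v' * x v') ->
  forall v, x v = 0.
Proof.
move=> hx v; apply: contrapT => /eqP xv.
pose m := [arg max_(w > v) `|x w|]%O.
have mmax w : `|x w| <= `|x m|.
  by rewrite /m; case: arg_maxP => // i _; apply.
have m0 : 0 < `|x m| by apply: lt_le_trans (mmax v); rewrite normr_gt0.
pose w := [arg max_(w > m | `|x w| == `|x m|) r w]%O.
have [xw wmax] : `|x w| = `|x m| /\
    forall w', `|x w'| = `|x m| -> r w' <= r w.
  rewrite /w; case: arg_maxP => // i /eqP xi imax.
  by split=> // w' /eqP; exact: imax.
case: (hx w) => [xw0|[u bu xwE]].
  by move: m0; rewrite -xw xw0 normr0 ltxx.
have [u' eu' ru'] := boundary_has_greater_successor bu.
have [d0 d1] := Gwf.2 _ bu.2.1.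
(* By the triangle inequality the average of [|x|] over the successors of [u] is at least its
   maximum, so every successor attains the maximum. *)
suff /wmax : `|x u'| = `|x m| by rewrite leNgt ru'.
apply: (@average_eq_ub _ _ (edge G u) (delta G u) (fun z => `|x z|)) => //.
rewrite -xw xwE; apply: le_trans (ler_norm_sum _ _ _) _ => /=.
by apply: ler_sum => i /d0/ltW di; rewrite normrM ger0_norm.
Qed.

(** The product of the denominators over the successors serves: it has at most [#|V|] factors, each
    at most [max_den G]. *)
Lemma random_common_den (u : V) : own G u = Random ->
  exists D : int, exists K : V -> int,
    [/\ 0 < D, D <= (max_den G ^ #|V|)%N%:Z &
        forall v', edge G u v' -> D%:~R * delta G u v' = (K v')%:~R].
Proof.
move=> uR.
exists (\prod_(v' | edge G u v') denq (delta G u v')).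
exists (fun v' => numq (delta G u v') *
  \prod_(w | edge G u w && (w != v')) denq (delta G u w)); split.
- by apply: prodr_gt0 => i _; exact: denq_gt0.
- have N0 : (0 < max_den G)%N by rewrite /max_den leq_maxl.
  apply: (@le_trans _ _ (\prod_(v' | edge G u v') (max_den G)%:Z)).
    apply: ler_prod => i ei; rewrite denq_ge0 /=.
    rewrite -(@gez0_abs (denq _)) ?denq_ge0 // lez_nat /max_den.
    rewrite leq_max; apply/orP; right.
    apply: leq_trans (@leq_bigmax_cond _ _
      (fun w => \max_(v' | edge G w v') `|denq (delta G w v')|%N) u _).
      exact: (@leq_bigmax_cond _ _ (fun w => `|denq (delta G u w)|%N)).
    by rewrite uR.
  rewrite prodr_const -natz -natrX natz lez_nat leq_pexp2l //; exact: max_card.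
- move=> v' ev'; rewrite (bigD1 v') //= !intrM mulrAC.
  by rewrite [X in X * _]mulrC -numqE.
Qed.

(** The row of [v] equates [x v] itself, not [x u], with the average at [u]; this holds for [r]
    because [r u = r v]. The last clause describes the homogeneous row in the form that
    [harmonic_kernel_trivial] takes. *)
Lemma class_equation (B0 : nat) (v : V) : (0 < B0)%N ->
  (~ (exists u, boundary_of_class G r v u) -> rat_with_den_le (r v) B0) ->
  exists a : V -> int, exists b : int,
    [/\ \sum_w (a w)%:~R * r w = b%:~R,
        \sum_w `|a w| <= (2 * max_den G ^ #|V| * B0)%N%:Z &
        forall x : V -> rat, \sum_w (a w)%:~R * x w = 0 ->
          x v = 0 \/ exists2 u, boundary_of_class G r v u &
            x v = \sum_(w | edge G u w) delta G u w * x w].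
Proof.
move=> B0_gt0 rv.
have N0 : (0 < max_den G ^ #|V|)%N by rewrite expn_gt0 /max_den leq_maxl.
(* The field is left open because the row is evaluated over [R] at the solution and over [rat] at
   kernel vectors. *)
have sum1 (K : numFieldType) (c : int) (x : V -> K) :
    \sum_w (c *+ (w == v))%:~R * x w = c%:~R * x v.
  rewrite (bigD1 v) //= eqxx mulr1n big1 ?addr0 // => w /negbTE ->.
  by rewrite mulr0n mul0r.
have [[u bu]|nb] := pselect (exists u, boundary_of_class G r v u); last first.
  have [p [q [q0 [qB rvE]]]] := rv nb.
  have qR (K : numFieldType) : q%:~R != 0 :> K by rewrite intr_eq0 gt_eqF.
  exists (fun w => q *+ (w == v)), p; split.
  - by rewrite sum1 rvE mulrC divfK //; exact: qR.
  - rewrite (bigD1 v) //= eqxx mulr1n big1 ?addr0 ?gtr0_norm //; last first.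
      by move=> w /negbTE ->; rewrite mulr0n normr0.
    apply: le_trans qB _; rewrite lez_nat leq_pmull //.
    by rewrite muln_gt0.
  - by move=> x; rewrite sum1 => /eqP; rewrite mulf_eq0 (negbTE (qR _)) => /eqP;
    left.
have uR := bu.2.1; have [d0 d1] := Gwf.2 _ uR.
have [D [K [D0 DN DK]]] := random_common_den uR.
have DR (F : numFieldType) : D%:~R != 0 :> F by rewrite intr_eq0 gt_eqF.
have sumE (F : numFieldType) (x : V -> F) :
    \sum_w (D *+ (w == v) - K w *+ edge G u w)%:~R * x w =
    D%:~R * (x v - \sum_(w | edge G u w) ratr (delta G u w) * x w).
  under eq_bigr do rewrite intrB mulrBl.
  rewrite sumrB sum1 mulrBr; congr (_ - _).
  rewrite mulr_sumr [RHS]big_mkcond /=; apply: eq_bigr => w _.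
  case: ifP => ew; last by rewrite mulr0n mul0r.
  rewrite mulr1n mulrA; congr (_ * _).
  by rewrite -[LHS](ratr_int F) -DK // rmorphM /= ratr_int.
exists (fun w => D *+ (w == v) - K w *+ edge G u w), 0; split.
- by rewrite sumE -r_harmonic // bu.1 subrr mulr0.
(* The [K w] on edges are nonnegative and add up to [D] because the probabilities add up to 1, so
   the row has l1-norm at most [2 * D]. *)
- have sK : \sum_w `|K w *+ edge G u w| = D.
    apply/eqP; rewrite -(eqr_int rat) rmorph_sum /=; apply/eqP.
    rewrite -[RHS]mulr1 -[X in _ = _ * X]d1 mulr_sumr [RHS]big_mkcond /=.
    apply: eq_bigr => w _; case: ifP => ew; last by rewrite mulr0n normr0.
    rewrite mulr1n DK // ger0_norm // -(ler_int rat) -DK //.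
    by rewrite mulr_ge0 ?ler0z ?ltW ?d0.
  have sD : \sum_w `|D *+ (w == v)| = D.
    rewrite (bigD1 v) //= eqxx mulr1n big1 ?addr0 ?gtr0_norm //.
    by move=> w /negbTE ->; rewrite mulr0n normr0.
  apply: (@le_trans _ _ (D + D)).
    rewrite -[X in _ <= X + _]sD -[X in _ <= _ + X]sK -big_split /=.
    apply: ler_sum => w _.
    exact: ler_normB.
  apply: (@le_trans _ _ (2 * max_den G ^ #|V|)%N%:Z).
    by rewrite mul2n -addnn PoszD lerD.
  by rewrite lez_nat leq_pmulr.
- move=> x /eqP; rewrite sumE mulf_eq0 (negbTE (DR _)) subr_eq0 => /eqP ->.
  right; exists u => //; apply: eq_bigr => w _.
  by rewrite /ratr divq_num_den.
Qed.

(** There is one row per vertex, each of l1-norm at most [2 * max_den G ^ #|V| * B0], so the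
    determinant is at most the product of [#|V|] such factors. *)
Theorem harmonic_vector_den (B0 : nat) : (0 < B0)%N ->
  (forall v, ~ (exists u, boundary_of_class G r v u) ->
     rat_with_den_le (r v) B0) ->
  forall v, rat_with_den_le (r v)
    (2 ^ #|V| * max_den G ^ (#|V| ^ 3) * B0 ^ #|V|)%N.
Proof.
move=> B0_gt0 rB v.
have /choice[a /choice[b ab]] := fun w => class_equation B0_gt0 (rB w).
pose A : 'M[int]_#|V| := \matrix_(i, j) a (enum_val i) (enum_val j).
have reE (F : nmodType) (f : V -> F) :
    \sum_w f w = \sum_(j < #|V|) f (enum_val j).
  by rewrite (reindex (@enum_val V predT)) //; exact/onW_bij/enum_val_bij.
(* [det0P] yields a left kernel vector, hence the transpose; passing to [rat] makes it a rational
   vector killed by every row. *)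
have dA : \det A != 0.
  rewrite -(intr_eq0 rat) -det_map_mx -det_tr; apply/negP => /det0P[y ynz yA].
  move/negP: ynz; apply; apply/eqP/rowP => j; rewrite [RHS]mxE.
  have -> : y 0 j = y 0 (enum_rank (enum_val j)) by rewrite enum_valK.
  apply: (harmonic_kernel_trivial (x := fun w => y 0 (enum_rank w))) => w.
  have [_ _] := ab w; apply; rewrite reE.
  have := congr1 (fun M : 'rV_#|V| => M 0 (enum_rank w)) yA.
  rewrite !mxE => {2}<-; apply: eq_bigr => k _.
  by rewrite !mxE enum_rankK enum_valK mulrC.
have [|p [q [q0 qA rvE]]] :=
    @integer_system_den R _ A (fun i => b (enum_val i))
      (fun i => r (enum_val i))
      dA _ (enum_rank v).
  move=> i; have [<- _ _] := ab (enum_val i); rewrite reE.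
  by apply: eq_bigr => j _; rewrite mxE.
exists p, q; split=> //; split; last by rewrite -rvE enum_rankK.
apply: le_trans qA _.
apply: (@le_trans _ _ (\prod_(i < #|V|) (2 * max_den G ^ #|V| * B0)%N%:Z)).
  apply: ler_prod => i _; rewrite sumr_ge0 //=.
  have [_ + _] := ab (enum_val i); rewrite reE.
  by under [X in _ -> X <= _]eq_bigr do rewrite mxE.
(* The product gives the exponent [#|V| * #|V|] for [max_den G], which is at most [#|V| ^ 3]. *)
rewrite prodr_const card_ord -natz -natrX natz lez_nat !expnMn -expnM.
rewrite leq_mul2r leq_mul2l leq_pexp2l ?orbT //.
  by rewrite /max_den leq_maxl.
by case: #|V| => // n; rewrite -(expnD _ 1 1) leq_pexp2l.
Qed.

End HarmonicVector.

(** * The measure induced by a pair of strategies *)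

Section Mixture.
Context d (T : measurableType d) (R : realType) (I : finType) (i0 : I).
Variables (c : I -> R) (mu : I -> {measure set T -> \bar R}).
Hypothesis c_ge0 : forall i, 0 <= c i.
Local Open Scope ereal_scope.

(** [msum] is indexed by natural numbers, so [I] is enumerated; indices below [#|I|] never reach the
    default [i0]. *)
Definition mixture : {measure set T -> \bar R} :=
  msum (fun k => mscale (NngNum (c_ge0 (nth i0 (enum I) k)))
                        (mu (nth i0 (enum I) k))) #|I|.

Lemma sum_nth_enum (F : I -> \bar R) :
  \sum_(k < #|I|) F (nth i0 (enum I) k) = \sum_i F i.
Proof. by rewrite -[RHS]big_enum (big_nth i0) big_mkord -cardE. Qed.

Lemma mixtureE A : mixture A = \sum_i (c i)%:E * mu i A.
Proof. by rewrite -sum_nth_enum. Qed.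

Lemma ge0_integral_mixture (f : T -> \bar R) : measurable_fun setT f ->
  (forall x, 0 <= f x) ->
  \int[mixture]_x f x = \sum_i (c i)%:E * \int[mu i]_x f x.
Proof.
move=> mf f0; rewrite -sum_nth_enum ge0_integral_measure_sum //.
by apply: eq_bigr => k _; rewrite ge0_integral_mscale.
Qed.

End Mixture.

(** * Cylinders and the shift on sequences of vertices *)

Section Plays.
Variables (V : finType) (v0 : V).

Lemma cyl_nil : cyl v0 [::] = setT.
Proof. by apply/seteqP; split. Qed.

Lemma measurable_cyl s : measurable (cyl v0 s : set (playT v0)).
Proof. by apply: sub_sigma_algebra; exists s. Qed.

(** Two cylinders are nested or disjoint, according to whether the shorter word is a prefix of the
    longer. *)
Lemma cylI s t : (size s <= size t)%N ->
  cyl v0 s `&` cyl v0 t = if s == take (size s) t then cyl v0 t else set0.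
Proof.
move=> st; case: ifPn => [/eqP sE|sN].
  apply/seteqP; split=> rho; first by case.
  move=> rt; split=> // i si.
  by rewrite sE nth_take // rt // (leq_trans si).
apply/seteqP; split=> rho //= [rs rt].
apply: (negP sN); apply/eqP; apply: (@eq_from_nth _ v0).
  by rewrite size_take_min (minn_idPl st).
by move=> i si; rewrite nth_take // -rs // rt // (leq_trans si).
Qed.

(** Uniqueness of measures on a generating family closed under intersection. The empty set is added
    to the cylinders for this closure, and the cylinder of the empty word is the whole space. *)
Lemma measure_eq_cyl (R : realType)
    (m1 m2 : {measure set (playT v0) -> \bar R}) :
  (forall s, m1 (cyl v0 s) = m2 (cyl v0 s)) -> (m1 setT < +oo)%E ->
  forall A, measurable A -> m1 A = m2 A.
Proof.
move=> m12 m1oo A.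
pose C : set (set (playT v0)) := cylinders v0 `|` [set set0].
apply: (@measure_unique _ R (playT v0) C (fun=> setT)).
- apply/seteqP; split; apply: smallest_sub => //.
  + by move=> B cB; apply: sub_sigma_algebra; left.
  + exact: sigma_algebra_measurable.
  + move=> B [cB|->]; [exact: sub_sigma_algebra|exact: measurable0].
- move=> B B' [[s ->]|->]; last by rewrite set0I; right.
  case=> [[t ->]|->]; last by rewrite setI0; right.
  have [st|/ltnW ts] := leqP (size s) (size t); last rewrite setIC.
    by rewrite cylI //; case: ifP => _; [left; exists t|right].
  by rewrite cylI //; case: ifP => _; [left; exists s|right].
- by move=> _; left; exists [::]; rewrite cyl_nil.
- by apply/seteqP; split=> // x _; exists 0%N.
- by move=> B [[s ->]|->]; rewrite ?measure0.
- by [].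
Qed.

Definition shift (rho : playT v0) : playT v0 := fun n => rho n.+1.

Lemma preimage_shift_cyl s :
  shift @^-1` cyl v0 s = \bigcup_(u in [set` enum V]) cyl v0 (u :: s).
Proof.
apply/seteqP; split=> rho /=.
  by move=> rs; exists (rho 0%N); rewrite /= ?mem_enum // => -[|i] // /rs.
by case=> u _ rs i si; exact: (rs i.+1).
Qed.

Lemma measurable_shift : measurable_fun setT shift.
Proof.
apply: (@measurability _ _ (playT v0) (playT v0) setT shift (cylinders v0))
  => //.
move=> _ [_ [s ->] <-]; rewrite setTI preimage_shift_cyl.
by apply: fin_bigcup_measurable => // u _; exact: measurable_cyl.
Qed.

HB.instance Definition _ :=
  isMeasurableFun.Build _ _ (playT v0) (playT v0) shift measurable_shift.

Lemma measure_preimage_shift_cyl (R : realType)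
    (m : {measure set (playT v0) -> \bar R}) s :
  m (shift @^-1` cyl v0 s) = (\sum_u m (cyl v0 (u :: s)))%E.
Proof.
rewrite preimage_shift_cyl measure_fin_bigcup //.
- by rewrite -fsbig_seq ?enum_uniq // big_enum.
- move=> u u' _ _ [rho [ru ru']].
  by have := ru 0%N isT; rewrite (ru' 0%N isT).
- by move=> u _; exact: measurable_cyl.
Qed.

End Plays.

(** * The first step of a play *)

Section Game.
Variables (R : realType) (V : finType) (v0 : V) (G : game V).
Hypothesis Gwf : wf_game G.

Lemma step_ge0 s1 s2 h v u : 0 <= step R G s1 s2 h v u.
Proof.
rewrite /step; case E: (own G v); rewrite ?ler0n //.
by case: ifP => // vu; rewrite ler0q ltW // (Gwf.2 _ E).1.
Qed.

Lemma step_sum1 s1 s2 h v : \sum_u step R G s1 s2 h v u = 1.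
Proof.
have delta1 (w : V) : \sum_u (w == u)%:R = 1 :> R.
  rewrite (bigD1 w) //= eqxx big1 ?addr0 // => u.
  by rewrite eq_sym => /negbTE ->.
rewrite /step; case E: (own G v); rewrite ?delta1 //.
by rewrite -big_mkcond /= -rmorph_sum /= (Gwf.2 _ E).2 rmorph1.
Qed.

(** The last clause is there because [phi + W] is nonnegative, so that integration theorems for
    nonnegative functions apply to it. *)
Lemma expect_bounded (P : probability (playT v0) R) (phi : playT v0 -> R)
    (W : R) :
  measurable_fun setT phi -> (forall x, `|phi x| <= W) ->
  exists e, [/\ expect P phi = e%:E, `|e| <= W &
    (\int[P]_x (phi x + W)%:E = (e + W)%:E)%E].
Proof.
move=> mphi phiW.
have PT : P [set: playT v0] = 1%E := probability_setT P.
have PTlt : (P [set: playT v0] < +oo)%E by rewrite probability_setT ltry.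
have bint (f : playT v0 -> R) (M : R) : measurable_fun setT f ->
    (forall x, `|f x| <= M) -> P.-integrable setT (EFin \o f).
  move=> mf fM; apply: measurable_bounded_integrable => //.
  exists M; split; rewrite ?num_real // => x Mx y _.
  exact: le_trans (fM y) (ltW Mx).
have iphi := bint _ _ mphi phiW.
have iW (c : R) : P.-integrable setT (EFin \o cst c) by apply: (bint _ `|c|).
have cstE (c : R) : (\int[P]_x (EFin \o cst c) x = c%:E)%E.
  rewrite (integral_cst P measurableT c%:E) -[RHS]mule1.
  by congr (_ * _)%E; exact: PT.
have fin : expect P phi \is a fin_num by exact: integral_fune_fin_num.
exists (fine (expect P phi)); rewrite fineK //; split=> //.
- rewrite ler_norml -!lee_fin fineK // -[X in (X <= _)%E]cstE.
  rewrite -[X in _ && (_ <= X)%E]cstE.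
  apply/andP; split; apply: le_integral => //.
  + by move=> x _; have := phiW x; rewrite lee_fin ler_norml => /andP[].
  + by move=> x _; have := phiW x; rewrite lee_fin ler_norml => /andP[].
- under eq_integral do rewrite EFinD.
  rewrite (integralD_EFin measurableT iphi (iW W)) [X in (_ + X)%E]cstE.
  by rewrite EFinD fineK.
Qed.

Section Strategies.
Variables (s1 s2 : seq V -> V -> V).
Hypotheses (s1P : is_strategy G Player1 s1) (s2P : is_strategy G Player2 s2).

Lemma step_edge h v u : step R G s1 s2 h v u != 0 -> edge G v u.
Proof.
rewrite /step; case E: (own G v).
- by have := s1P h E; case: (s1 h v =P u) => [<-|_] //; rewrite eqxx.
- by have := s2P h E; case: (s2 h v =P u) => [<-|_] //; rewrite eqxx.
- by case: ifP => //; rewrite eqxx.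
Qed.

Lemma path_prob_path h v s :
  path_prob R G s1 s2 h v s != 0 -> path (edge G) v s.
Proof.
elim: s h v => //= u s IH h v.
by rewrite mulf_eq0 negb_or => /andP[/step_edge -> /IH].
Qed.

(** A sequence that is not a play has a finite prefix of probability 0, and there are only countably
    many finite words. *)
Lemma induced_measure_negligible_non_play v (P : probability (playT v0) R) :
  induced_measure G v s1 s2 P ->
  P.-negligible [set rho : playT v0 | ~ is_play G rho].
Proof.
move=> indP.
pose F n : set (playT v0) :=
  if @unpickle (seq V) n is Some s then
    if P (cyl v0 s) == 0%E then cyl v0 s else set0 else set0.
apply: (@negligibleS _ _ _ _ (\bigcup_n F n)); last first.
  apply: negligible_bigcup => n; rewrite /F.
  case: unpickle => [s|]; last exact: negligible_set0.
  case: ifPn => [/eqP Ps|_]; last exact: negligible_set0.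
  by apply/negligibleP => //; exact: measurable_cyl.
move=> rho /= /existsNP[i /negP nei].
(* The prefix has length [i + 2], so that it contains the faulty step from [rho i] to [rho i.+1]. *)
exists (pickle (rho 0%N :: mkseq (fun k => rho k.+1) i.+1)) => //.
rewrite /F pickleK indP ifT; last first.
  rewrite eqe mulf_eq0; apply/orP; right; apply: contraT => /path_prob_path.
  move=> /(pathP v0)/(_ i); rewrite size_mkseq => /(_ (ltnSn i)).
  rewrite nth_mkseq // (_ : nth _ _ i = rho i) ?(negbTE nei) //.
  by case: i {nei} => // i; rewrite /= nth_mkseq // ltnW.
case=> // k; rewrite /= size_map size_iota ltnS => ki.
by rewrite (nth_mkseq v0 (fun k => rho k.+1)).
Qed.

End Strategies.

(* [t u] is played from the second vertex [u] on; [head u h] is the first vertex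
   of the prefix [rcons h u]. *)
Definition continues (v : V) (s : seq V -> V -> V) (t : V -> seq V -> V -> V) :=
  forall h u, s (v :: h) u = t (head u h) h u.

Section OneStep.
Variables (v : V) (s1 s2 : seq V -> V -> V) (t1 t2 : V -> seq V -> V -> V).
Hypotheses (st1 : continues v s1 t1) (st2 : continues v s2 t2).

(** Extending the history does not change the first vertex after [v], so the same [t1] and [t2]
    apply along the whole path. *)
Lemma path_prob_continues h u s :
  path_prob R G s1 s2 (v :: h) u s =
  path_prob R G (t1 (head u h)) (t2 (head u h)) h u s.
Proof.
elim: s h u => //= y s IH h u; rewrite IH.
have -> : head y (rcons h u) = head u h by case: h.
by congr (_ * _); rewrite /step st1 st2.
Qed.

Variables (P : probability (playT v0) R) (Q : V -> probability (playT v0) R).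
Hypothesis indP : induced_measure G v s1 s2 P.
Hypothesis indQ : forall u, induced_measure G u (t1 u) (t2 u) (Q u).

(** Both measures give a nonempty word [x :: xs] the probability of the step from [v] to [x] times
    that of continuing along [xs]. *)
Lemma pushforward_shift A : measurable A ->
  pushforward P (@shift V v0) A =
  mixture v0 Q (step_ge0 s1 s2 [::] v) A.
Proof.
have pc x xs : pushforward P (@shift V v0) (cyl v0 (x :: xs)) =
    mixture v0 Q (step_ge0 s1 s2 [::] v) (cyl v0 (x :: xs)).
  rewrite mixtureE /pushforward measure_preimage_shift_cyl.
  rewrite (bigD1 v) //= [X in (_ + X)%E]big1 ?adde0; last first.
    by move=> u /negbTE uv; rewrite indP uv mul0r.
  rewrite (bigD1 x) //= [X in (_ = _ + X)%E]big1 ?adde0; last first.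
    by move=> u /negbTE xu; rewrite indQ eq_sym xu mul0r mule0.
  by rewrite indP indQ !eqxx !mul1r /= path_prob_continues -EFinM.
apply: measure_eq_cyl; last first.
  by rewrite -[X in (X < _)%E]/(P setT) probability_setT ltry.
(* [induced_measure] speaks of nonempty words only; the cylinder of the empty word is split by its
   first vertex. *)
case=> [|x xs]; last exact: pc.
have shT (m : {measure set (playT v0) -> \bar R}) :
    m (cyl v0 [::]) = (\sum_u m (cyl v0 [:: u]))%E.
  by rewrite -measure_preimage_shift_cyl; congr (m _); apply/seteqP; split.
by rewrite shT [RHS]shT; apply: eq_bigr => u _; exact: pc.
Qed.

Variables (phi : playT v0 -> R) (W : R).
Hypotheses (mphi : measurable_fun setT phi) (phiW : forall x, `|phi x| <= W).
Hypothesis phi_pi : prefix_independent G phi.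
Hypotheses (s1P : is_strategy G Player1 s1) (s2P : is_strategy G Player2 s2).

(** By prefix independence [phi] agrees almost everywhere with its composition with the shift, so
    its integral can be taken under the pushforward, which is the mixture of the [Q u]. *)
Lemma expect_one_step :
  expect P phi = (\sum_u (step R G s1 s2 [::] v u)%:E * expect (Q u) phi)%E.
Proof.
have [e [-> _ eW]] := expect_bounded P mphi phiW.
have /choice[f fP] u := expect_bounded (Q u) mphi phiW.
pose psi (x : playT v0) := (phi x + W)%:E.
have mpsi : measurable_fun setT psi.
  by apply/measurable_EFinP; exact: measurable_funD.
have psi0 x : (0 <= psi x)%E.
  rewrite lee_fin -lerBlDr sub0r.
  by have := phiW x; rewrite ler_norml => /andP[].
have : (\int[P]_x psi x = \int[P]_x (psi \o @shift V v0) x)%E.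
  apply: ae_eq_integral => //.
    exact: (measurableT_comp mpsi (@measurable_shift V v0)).
  apply: (@negligibleS _ _ _ _ [set rho : playT v0 | ~ is_play G rho]).
    move=> rho /= npsi rho_play; apply: npsi => _.
    rewrite /psi /=; congr (_ + _)%:E.
    apply: (phi_pi (i := 1) (j := 0)) => // i; exact: rho_play.
  exact: (induced_measure_negligible_non_play s1P s2P indP).
rewrite eW => /esym.
rewrite -[X in (\int[_]_(_ in X) _)%E](preimage_setT (@shift V v0)).
rewrite -(ge0_integral_pushforward (@measurable_shift V v0) P measurableT mpsi)
  //.
rewrite (eq_measure_integral (mixture v0 Q (step_ge0 s1 s2 [::] v)));
  last first.
  by move=> A mA _; exact: pushforward_shift.
rewrite ge0_integral_mixture //.
under eq_bigr => u _.
  have [_ _ ->] := fP u; rewrite -EFinM mulrDr; over.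
(* The weights add up to 1, so the added constant [W] cancels on both sides. *)
rewrite sumEFin big_split /= -mulr_suml step_sum1 mul1r => -[/addIr <-].
rewrite -sumEFin; apply: eq_bigr => u _.
by have [-> _ _] := fP u; rewrite EFinM.
Qed.

End OneStep.
End Game.

(** * Values at random vertices *)

Section Bellman.
Variables (R : realType) (V : finType) (v0 : V) (G : game V).
Variable Pm :
  V -> (seq V -> V -> V) -> (seq V -> V -> V) -> probability (playT v0) R.
Variable phi : playT v0 -> R.
Hypothesis Gwf : wf_game G.
Hypothesis Pm_induced : forall v s1 s2,
  is_strategy G Player1 s1 -> is_strategy G Player2 s2 ->
  induced_measure G v s1 s2 (Pm v s1 s2).
Hypothesis mphi : measurable_fun setT phi.
Hypothesis phi_bounded : bounded_obj phi.
Hypothesis phi_pi : prefix_independent G phi.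

Lemma strategy_exists i : exists s, is_strategy G i s.
Proof.
by have /choice[f fP] := Gwf.1; exists (fun _ => f) => h v _; exact: fP.
Qed.

Lemma glue_strategies i v t : (forall u, is_strategy G i (t u)) ->
  exists2 s, is_strategy G i s & continues v s t.
Proof.
move=> tP.
(* On the empty history any legal move will do; [t u h u] is one. *)
exists (fun h u => if h is _ :: h' then t (head u h') h' u else t u h u) => //.
by move=> [|x h] u iu; exact: tP.
Qed.

Lemma shifted_strategy i v s : is_strategy G i s ->
  is_strategy G i (fun h => s (v :: h)).
Proof. by move=> sP h u; exact: sP. Qed.

(** At a random vertex the weights of the first step are given by [delta], whatever the
    strategies. *)
Lemma expect_random v s1 s2 t1 t2 : own G v = Random ->
  is_strategy G Player1 s1 -> is_strategy G Player2 s2 ->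
  (forall u, is_strategy G Player1 (t1 u)) ->
  (forall u, is_strategy G Player2 (t2 u)) ->
  continues v s1 t1 -> continues v s2 t2 ->
  expect (Pm v s1 s2) phi = (\sum_(u | edge G v u)
    (ratr (delta G v u))%:E * expect (Pm u (t1 u) (t2 u)) phi)%E.
Proof.
move=> vR s1P s2P t1P t2P st1 st2; have [W phiW] := phi_bounded.
rewrite (expect_one_step Gwf st1 st2 (Pm_induced v s1P s2P)
  (fun u => Pm_induced u (t1P u) (t2P u)) mphi phiW phi_pi s1P s2P).
rewrite [RHS]big_mkcond /=; apply: eq_bigr => u _.
by rewrite /step vR; case: ifP => // _; rewrite mul0e.
Qed.

Lemma lower_value_fin v : lower_value G Pm phi v \is a fin_num.
Proof.
have [W phiW] := phi_bounded.
have [s1 s1P] := strategy_exists Player1.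
have [s2 s2P] := strategy_exists Player2.
have bnd t1 t2 : (- W%:R%:E <= expect (Pm v t1 t2) phi <= W%:R%:E)%E.
  have [e [-> + _]] := expect_bounded (Pm v t1 t2) mphi phiW.
  by rewrite ler_norml -EFinN !lee_fin.
rewrite fin_numElt; apply/andP; split.
  apply: (@lt_le_trans _ _ (- W%:R%:E)%E); first by rewrite -EFinN ltNyr.
  apply: (@le_trans _ _ (ereal_inf [set y | exists s2,
    is_strategy G Player2 s2 /\ y = expect (Pm v s1 s2) phi])).
    by apply: le_ereal_inf_tmp => _ [t2 [_ ->]]; have /andP[] := bnd s1 t2.
  by apply: ereal_sup_ubound; exists s1.
apply: (@le_lt_trans _ _ W%:R%:E); last by rewrite ltry.
apply: ge_ereal_sup => _ [t1 [t1P ->]].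
apply: (@le_trans _ _ (expect (Pm v t1 s2) phi)).
  by apply: ereal_inf_lbound; exists s2.
by have /andP[] := bnd t1 s2.
Qed.

Lemma delta_sum1 v : own G v = Random ->
  \sum_(u | edge G v u) ratr (delta G v u) = 1 :> R.
Proof. by move=> vR; rewrite -rmorph_sum /= (Gwf.2 _ vR).2 rmorph1. Qed.

Lemma delta_ge0 v u : own G v = Random -> edge G v u ->
  0 <= ratr (delta G v u) :> R.
Proof. by move=> vR vu; rewrite ler0q ltW // (Gwf.2 _ vR).1. Qed.

Lemma average_shift v (f : V -> R) e : own G v = Random ->
  \sum_(u | edge G v u) ratr (delta G v u) * (f u + e) =
  \sum_(u | edge G v u) ratr (delta G v u) * f u + e.
Proof.
move=> vR; under eq_bigr do rewrite mulrDr.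
by rewrite big_split /= -mulr_suml delta_sum1 // mul1r.
Qed.

(** Against a fixed [s1], Player 2 waits for the first step to some [u] and then plays a reply to
    the rest of [s1] that brings the expectation below the value of [u] plus [e]. *)
Lemma lower_value_le_average v : own G v = Random ->
  fine (lower_value G Pm phi v) <= \sum_(u | edge G v u)
    ratr (delta G v u) * fine (lower_value G Pm phi u).
Proof.
move=> vR; apply/ler_addgt0Pr => e e0.
rewrite -lee_fin fineK ?lower_value_fin //.
apply: ge_ereal_sup => _ [s1 [s1P ->]].
have /choice[t2 t2P] u : exists t2, is_strategy G Player2 t2 /\
    (expect (Pm u (fun h => s1 (v :: h)) t2) phi <
     (fine (lower_value G Pm phi u) + e)%:E)%E.
  have : (ereal_inf [set y | exists s2, is_strategy G Player2 s2 /\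
      y = expect (Pm u (fun h => s1 (v :: h)) s2) phi] <
      (fine (lower_value G Pm phi u) + e)%:E)%E.
    apply: (@le_lt_trans _ _ (lower_value G Pm phi u)).
      apply: ereal_sup_ubound; exists (fun h => s1 (v :: h)); split => //.
      exact: shifted_strategy.
    by rewrite -[ltLHS]fineK ?lower_value_fin // lte_fin ltrDl.
  by move=> /ereal_inf_lt[_ [t2 [t2P ->]] lt]; exists t2.
have [s2 s2P st2] := glue_strategies v (fun u => (t2P u).1).
apply: (@le_trans _ _ (expect (Pm v s1 s2) phi)).
  by apply: ereal_inf_lbound; exists s2.
rewrite (@expect_random v s1 s2 (fun _ h => s1 (v :: h)) t2) //; last 2 first.
- by move=> u; exact: shifted_strategy.
- by move=> u; exact: (t2P u).1.
rewrite -average_shift // -sumEFin; apply: lee_sum => u vu.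
have d0 : (0 <= (ratr (delta G v u))%:E :> \bar R)%E.
  by rewrite lee_fin delta_ge0.
exact: (lee_wpmul2l d0 (ltW (t2P u).2)).
Qed.

Hypothesis determined :
  forall v, lower_value G Pm phi v = upper_value G Pm phi v.

(** The dual argument, with Player 1 gluing near-optimal replies to the rest of a fixed [s2]. *)
Lemma average_le_lower_value v : own G v = Random ->
  \sum_(u | edge G v u) ratr (delta G v u) * fine (lower_value G Pm phi u)
  <= fine (lower_value G Pm phi v).
Proof.
move=> vR; apply/ler_addgt0Pr => e e0.
rewrite -lerBlDr -average_shift // -lee_fin fineK ?lower_value_fin //.
(* Determinacy turns the value into an infimum over [s2], so that [s2] is fixed before Player 1
   replies. *)
rewrite determined; apply: le_ereal_inf_tmp => _ [s2 [s2P ->]].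
have /choice[t1 t1P] u : exists t1, is_strategy G Player1 t1 /\
    ((fine (lower_value G Pm phi u) - e)%:E <
     expect (Pm u t1 (fun h => s2 (v :: h))) phi)%E.
  have : ((fine (lower_value G Pm phi u) - e)%:E <
      ereal_sup [set y | exists s1, is_strategy G Player1 s1 /\
      y = expect (Pm u s1 (fun h => s2 (v :: h))) phi])%E.
    apply: (@lt_le_trans _ _ (lower_value G Pm phi u)).
      by rewrite -[ltRHS]fineK ?lower_value_fin // lte_fin ltrBlDr ltrDl.
    rewrite determined.
    apply: ereal_inf_lbound; exists (fun h => s2 (v :: h)); split => //.
    exact: shifted_strategy.
  by move=> /ereal_sup_gt[_ [t1 [t1P ->]] lt]; exists t1.
have [s1 s1P st1] := glue_strategies v (fun u => (t1P u).1).
apply: (@le_trans _ _ (expect (Pm v s1 s2) phi)); last first.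
  by apply: ereal_sup_ubound; exists s1.
rewrite (@expect_random v s1 s2 t1 (fun _ h => s2 (v :: h))) //; last 2 first.
- by move=> u; exact: (t1P u).1.
- by move=> u; exact: shifted_strategy.
rewrite -sumEFin; apply: lee_sum => u vu.
have d0 : (0 <= (ratr (delta G v u))%:E :> \bar R)%E.
  by rewrite lee_fin delta_ge0.
exact: (lee_wpmul2l d0 (ltW (t1P u).2)).
Qed.

End Bellman.

Theorem theorem11 (R : realType) (V : finType) (v0 : V) (G : game V)
  (Pm : V -> (seq V -> V -> V) -> (seq V -> V -> V) -> probability (playT v0) R)
  (phi : playT v0 -> R) (B0 : nat) :
  wf_game G ->
  (forall v s1 s2, is_strategy G Player1 s1 -> is_strategy G Player2 s2 ->
     induced_measure G v s1 s2 (Pm v s1 s2)) ->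
  measurable_fun setT phi ->
  bounded_obj phi ->
  prefix_independent G phi ->
  (forall v, lower_value G Pm phi v = upper_value G Pm phi v) ->
  (0 < B0)%N ->
  (forall v, ~ (exists u, boundary_of_class G (fun x => fine (lower_value G Pm phi x)) v u) ->
     rat_with_den_le (fine (lower_value G Pm phi v)) B0) ->
  forall v, rat_with_den_le (fine (lower_value G Pm phi v))
    (2 ^ #|V| * max_den G ^ (#|V| ^ 3) * B0 ^ #|V|)%N.
Proof.
move=> Gwf Pm_induced mphi phi_bounded phi_pi determined B0_gt0 rB.
(* What remains is that the value vector is harmonic at random vertices, which the two inequalities
   give. *)
apply: harmonic_vector_den => // v vR; apply/eqP; rewrite eq_le.
by rewrite lower_value_le_average ?average_le_lower_value.
Qed.
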